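(* For any real-rooted polynomial $q$ of degree $d$, $$(d-1)\,q'(x)^2-d\,q(x)\,q''(x)\ge 0\qquad\text{for all real }x,$$ and the inequality is strict when the roots of $q$ are simple.
   Context: A polynomial is real-rooted if all its roots are real. $q'$ and $q''$ denote the first and second derivatives of $q$.
   Formalization: The strict inequality is stated only for degree d at least 2, because for d = 0 or d = 1 the expression is identically zero even when the roots are simple (for example q(x) = x); the weak inequality holds for every d. *)

(* Defs.v *)
From mathcomp Require Import all_boot all_order all_algebra.
From mathcomp Require Import complex.
From mathcomp Require Import reals.

Set Implicit Arguments.
Unset Strict Implicit.
Unset Printing Implicit Defensive.

Import Order.TTheory GRing.Theory Num.Theory.

Local Open Scope ring_scope.
Local Open Scope complex_scope.

(* The roots of a real polynomial are its complex roots: [root q] on R itself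
   would not see the non-real ones. *)
Definition complexify (R : realType) (q : {poly R}) : {poly R[i]} :=
  map_poly (real_complex R) q.

Definition real_rooted (R : realType) (q : {poly R}) : Prop :=
  forall z : R[i], root (complexify q) z -> z \is Num.real.

Definition simple_roots (R : realType) (q : {poly R}) : Prop :=
  forall z : R[i], root (complexify q) z -> mup z (complexify q) = 1%N.

(* Main.v *)
Require Import Defs.
From mathcomp Require Import all_boot all_order all_algebra.
From mathcomp Require Import complex ring.
From mathcomp Require Import reals.

(** The left-hand side is Laguerre's expression
    [L_d(q) = (d - 1) q'^2 - d q q''], and everything rests on how it changes
    when one linear factor is added:
<<
    n L_{n+1}((X - a) p) = (n p - (x - a) p')^2 + (n + 1) (x - a)^2 L_n(p)
>>
    ([laguerre_XsubC_mul]).  Both terms on the right are nonnegative as soon as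
    [L_n(p) >= 0], where [n] will be the degree of [p].  Induction on the list
    of roots therefore gives the inequality for products of linear factors.
    For strictness, suppose that [n > 0], that
    [L_n(p) > 0] and that [a] is not a root of [p]: the second term is positive
    when [x != a], and the first one is [(n p(a))^2 > 0] when [x = a].  This
    induction starts at [n = 1], where the right-hand side is the square of the
    difference of the two roots.

    The leading coefficient only scales [L_d] by its square.  What remains is
    that a real-rooted [q] is a constant times a product of real linear
    factors: its factorization over the complex numbers has real roots, hence
    descends to the reals, and simple roots give a duplicate-free list
    ([real_rooted_factor]). *)

Set Implicit Arguments.
Unset Strict Implicit.
Unset Printing Implicit Defensive.

Import Order.TTheory GRing.Theory Num.Theory.

Local Open Scope ring_scope.

Definition laguerre (F : nzRingType) (d : nat) (p : {poly F}) (x : F) : F :=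
  (d%:R - 1) * p^`().[x] ^+ 2 - d%:R * p.[x] * p^`(2).[x].

Lemma laguerreZ (F : comNzRingType) d (c : F) (p : {poly F}) x :
  laguerre d (c *: p) x = c ^+ 2 * laguerre d p x.
Proof. by rewrite /laguerre derivnZ derivZ !hornerZ; ring. Qed.

(** Write [t] for [x - a].  Expanding, [L_{n+1}((X - a) p)] equals
    [n p^2 - 2 t p p' + t^2 (n p'^2 - (n + 1) p p'')].  Multiplied by [n], the
    coefficient of [t^2 p'^2] is [n^2 = (n + 1)(n - 1) + 1]: the first summand
    belongs to [(n + 1) t^2 L_n(p)], and the remaining [t^2 p'^2] completes the
    square of [n p - t p']. *)
Lemma laguerre_XsubC_mul (F : comNzRingType) n (a : F) (p : {poly F}) x :
  n%:R * laguerre n.+1 (('X - a%:P) * p) x =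
  (n%:R * p.[x] - (x - a) * p^`().[x]) ^+ 2
  + n.+1%:R * (x - a) ^+ 2 * laguerre n p x.
Proof.
rewrite /laguerre !derivSn !derivn0 derivM derivXsubC mul1r derivD derivM.
rewrite derivXsubC mul1r !(hornerXsubC, hornerD, hornerM) -natr1.
ring.
Qed.

Lemma laguerre_const (F : nzRingType) (c x : F) : laguerre 0 c%:P x = 0.
Proof. by rewrite /laguerre derivC horner0 expr0n !mul0r mulr0 subr0. Qed.

Lemma laguerre_linear (F : nzRingType) (a x : F) : laguerre 1 ('X - a%:P) x = 0.
Proof.
by rewrite /laguerre derivSn derivn1 derivXsubC derivC horner0 subrr mul0r
           mulr0 subr0.
Qed.

Section LinearFactors.

Variable F : realFieldType.
Implicit Types (rs : seq F) (x : F).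

Lemma laguerre_prod_ge0 rs x :
  0 <= laguerre (size rs) (\prod_(r <- rs) ('X - r%:P)) x.
Proof.
elim: rs => [|a rs IHrs]; first by rewrite big_nil laguerre_const.
(* For n = 0 the recurrence reads 0 = 0 and says nothing about the product. *)
case: (posnP (size rs)) => [/size0nil->|n_gt0].
  by rewrite big_seq1 laguerre_linear.
rewrite big_cons /= -(pmulr_rge0 _ (_ : 0 < (size rs)%:R)) ?ltr0n //.
rewrite laguerre_XsubC_mul addr_ge0 ?sqr_ge0 //.
by rewrite mulr_ge0 ?IHrs // mulr_ge0 ?ler0n ?sqr_ge0.
Qed.

Lemma laguerre_prod_gt0 rs x : uniq rs -> (1 < size rs)%N ->
  0 < laguerre (size rs) (\prod_(r <- rs) ('X - r%:P)) x.
Proof.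
elim: rs => // a rs IHrs /= /andP[a_notin rs_uniq]; rewrite ltnS => n_gt0.
rewrite big_cons -(pmulr_rgt0 _ (_ : 0 < (size rs)%:R)) ?ltr0n //.
rewrite laguerre_XsubC_mul.
case: (ltnP 1 (size rs)) => [n_gt1 | n_le1]; last first.
  (* With p = X - b, the square is that of (x - b) - (x - a) = a - b. *)
  case: rs n_gt0 n_le1 a_notin {IHrs rs_uniq} => [|b []] // _ _.
  rewrite inE big_seq1 laguerre_linear derivXsubC !hornerE => a_neq_b.
  have -> : x - b - (x - a) = a - b by ring.
  by rewrite exprn_even_gt0 //= subr_eq0.
have [-> | x_neq_a] := eqVneq x a.
  (* At the new root only the square (n p(a)) ^ 2 survives. *)
  rewrite subrr !(mul0r, expr0n, mulr0) addr0 subr0 exprn_even_gt0 //=.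
  rewrite mulf_neq0 ?pnatr_eq0 -?lt0n //.
  by rewrite -[_ == 0]/(root _ a) root_prod_XsubC.
rewrite ltr_wpDl ?sqr_ge0 // mulr_gt0 ?IHrs // mulr_gt0 ?ltr0n //.
by rewrite exprn_even_gt0 //= subr_eq0.
Qed.

End LinearFactors.

(** The complex roots are real, so they form the image of a list of reals, and
    the injectivity of the embedding of polynomials brings the factorization
    back; the multiplicity of a root is its number of occurrences in the
    list. *)
Lemma real_rooted_factor (R : realType) (q : {poly R}) : q != 0 ->
    real_rooted q ->
  exists2 rs : seq R, q = lead_coef q *: \prod_(r <- rs) ('X - r%:P)
    & simple_roots q -> uniq rs.
Proof.
move=> q_neq0 q_real.
have [zs q_zs] := closed_field_poly_normal (complexify q).
have c_neq0 : lead_coef (complexify q) != 0.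
  by rewrite lead_coef_eq0 map_poly_eq0.
have root_zs z : root (complexify q) z = (z \in zs).
  by rewrite q_zs rootZ // root_prod_XsubC.
have zs_real : zs = map (real_complex R) (map (@complex.Re R) zs).
  rewrite -map_comp map_id_in // => z; rewrite -root_zs => /q_real.
  exact: RRe_real.
exists (map (@complex.Re R) zs).
  apply: (map_poly_inj (real_complex R)).
  rewrite linearZ /= map_prod_XsubC -lead_coef_map.
  by rewrite -(big_map (real_complex R) predT (fun z => 'X - z%:P)) /= -zs_real.
move=> q_simple; suff : uniq zs by rewrite {1}zs_real => /map_uniq.
apply: count_mem_uniq => z; rewrite -root_zs.
have [z_root | z_notin] := boolP (root (complexify q) z); last first.
  by apply/count_memPn; rewrite -root_zs.
have := q_simple z z_root.
by rewrite q_zs -mul_polyC mupMr ?rootC // mu_prod_XsubC => ->.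
Qed.

Theorem proposition1 (R : realType) (d : nat) (q : {poly R})
    (size_q : size q = d.+1) (* q is nonzero of degree exactly d *)
    (q_real_rooted : real_rooted q) :
  (forall x : R,
     0 <= (d%:R - 1) * q^`().[x] ^+ 2 - d%:R * q.[x] * q^`(2).[x])
  /\
  ((2 <= d)%N -> simple_roots q ->
   forall x : R,
     0 < (d%:R - 1) * q^`().[x] ^+ 2 - d%:R * q.[x] * q^`(2).[x]).
Proof.
have q_neq0 : q != 0 by rewrite -size_poly_gt0 size_q.
have c_neq0 : lead_coef q != 0 by rewrite lead_coef_eq0.
have [rs q_rs rs_uniq] := real_rooted_factor q_neq0 q_real_rooted.
have d_rs : d = size rs.
  by apply: succn_inj; rewrite -size_q q_rs size_scale // size_prod_XsubC.
have laguerre_q x : laguerre d q x =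
    lead_coef q ^+ 2 * laguerre (size rs) (\prod_(r <- rs) ('X - r%:P)) x.
  by rewrite {1}q_rs laguerreZ d_rs.
split=> [x | d_ge2 q_simple x]; rewrite -/(laguerre d q x) laguerre_q.
  by rewrite mulr_ge0 ?sqr_ge0 ?laguerre_prod_ge0.
rewrite mulr_gt0 ?exprn_even_gt0 ?c_neq0 // laguerre_prod_gt0 -?d_rs //.
exact: rs_uniq.
Qed.
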